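(* Let $G$ be a Polish group and let $A\subseteq G$ be a conjugacy invariant set. Suppose that $A=\bigcup_{n\in\omega}A_n$ where each $A_n$ is Borel, and that there is a conjugacy invariant set $B\subseteq G$ such that $1\in\overline{B}$ and $B\cap\bigcup_{n\in\omega}A_n^{-1}A_n=\emptyset$. Then $A$ is Haar null.
   Context: A set $S\subseteq G$ is conjugacy invariant if $gSg^{-1}=S$ for all $g\in G$. $A_n^{-1}A_n=\{a^{-1}b: a,b\in A_n\}$. For a Polish group $G$, a Borel set $B\subseteq G$ is Haar null if there is a Borel probability measure $\mu$ on $G$ with $\mu(gBh)=0$ for all $g,h\in G$; an arbitrary set is Haar null if it is contained in a Borel Haar null set. *)

(* Defs.v *)
From HB Require Import structures.
From mathcomp Require Import all_boot all_order all_algebra.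
From mathcomp Require Import all_classical all_reals all_analysis.

Set Implicit Arguments.
Unset Strict Implicit.
Unset Printing Implicit Defensive.

Import Order.TTheory GRing.Theory Num.Theory.
Import numFieldNormedType.Exports.

Local Open Scope classical_set_scope.
Local Open Scope ring_scope.

(* The base point carried by [PointedTopological] is arbitrary and unrelated to
   the group structure; the library's generated sigma-algebras require one. *)
HB.structure Definition PreTopologicalGroup :=
  {G of PointedTopological G & Group G}.

HB.mixin Record PreTopologicalGroup_isTopologicalGroup G
    of PreTopologicalGroup G := {
  mulg_continuous : continuous (fun xy : G * G => (xy.1 * xy.2)%g) ;
  invg_continuous : continuous (fun x : G => (x^-1)%g) ;
}.

#[short(type="topologicalGroupType")]
HB.structure Definition TopologicalGroup :=
  {G of PreTopologicalGroup G & PreTopologicalGroup_isTopologicalGroup G}.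

Section polish_space.
Context (R : realType) (T : topologicalType).
Implicit Type d : T -> T -> R.

Definition separable := exists2 D : set T, countable D & dense D.

Definition is_metric d :=
  [/\ forall x y, 0 <= d x y,
      forall x y, d x y = 0 <-> x = y,
      forall x y, d x y = d y x &
      forall x y z, d x z <= d x y + d y z].

Definition metric_induces_topology d :=
  forall U : set T, open U <->
    forall x, U x -> exists2 e, 0 < e & [set y | d x y < e] `<=` U.

Definition metric_cauchy_seq d (u : nat -> T) :=
  forall e, 0 < e ->
    exists N, forall m n, (N <= m)%N -> (N <= n)%N -> d (u m) (u n) < e.

Definition metric_cvg_seq d (u : nat -> T) (l : T) :=
  forall e, 0 < e -> exists N, forall n, (N <= n)%N -> d (u n) l < e.

Definition metric_complete d :=
  forall u, metric_cauchy_seq d u -> exists l, metric_cvg_seq d u l.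

Definition completely_metrizable :=
  exists d, [/\ is_metric d, metric_induces_topology d & metric_complete d].

Definition polish_space := separable /\ completely_metrizable.

End polish_space.

Section haar_null.
Context (R : realType) (G : topologicalGroupType).
Implicit Types A B S : set G.

Definition conjugacy_invariant S :=
  forall g : G, [set (g * s * g^-1)%g | s in S] = S.

Definition invg_mulg_set A : set G := [set (a^-1 * b)%g | a in A & b in A].

Definition borelType := g_sigma_algebraType (@open G).

Definition borel_set B := measurable (B : set borelType).

Definition borel_haar_null B :=
  borel_set B /\
  exists mu : probability borelType R,
    forall g h : G, mu [set (g * b * h)%g | b in B] = 0%E.

Definition haar_null A := exists2 B, borel_haar_null B & A `<=` B.

End haar_null.

(* Main.v *)
(** By conjugacy invariance [g A h] is the left translate [g h A], so it suffices
to find a probability measure that vanishes on all left translates of every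
[A_ n].  Choose [b_k] in [B] converging to [1] so fast that for every bit
sequence [e] the product [b_0^(e 0) b_1^(e 1) ...] converges, and let [mu] be
the law of this product for random bits, realised as the binary digits of a
uniform point of [[0, 1]].  Switching on the [k]-th bit turns [x = u v] into
[y = u b_k v], and [x^-1 y = v^-1 b_k v] lies in [B], hence not in
[(A_ n)^-1 (A_ n)].  The set [E] of the points of [[0, 1]] sent to [g (A_ n)]
therefore contains no two points that differ in exactly one bit.  So [E] fills at
most half of each dyadic interval, and has measure [0] by the Lebesgue density
theorem. *)

Require Import Defs.
From HB Require Import structures.
From mathcomp Require Import all_boot all_order all_algebra.
From mathcomp Require Import all_classical all_reals all_analysis.
From mathcomp Require Import measurable_realfun lra.
Import Order.TTheory GRing.Theory Num.Theory.
Import numFieldNormedType.Exports.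

Local Open Scope classical_set_scope.
Local Open Scope ring_scope.

(** * Translations and binary digits of real numbers *)

Lemma lebesgue_measure_preimage_addr (R : realType) (c : R) (A : set R) :
  measurable A ->
  lebesgue_measure ((fun x => x + c) @^-1` A) = lebesgue_measure A.
Proof.
pose f : measurableTypeR R -> measurableTypeR R := fun x => x + c.
have mf : measurable_fun [set: measurableTypeR R] f by exact: measurable_funD.
pose mfM := isMeasurableFun.Build _ _ _ _ f mf.
pose F : {mfun measurableTypeR R >-> measurableTypeR R} := HB.pack f mfM.
move=> mA; rewrite [RHS](@lebesgue_measure_unique R
  (pushforward (@lebesgue_measure R) F))//.
move=> _ [[a b] _ <-] /=; rewrite /pushforward /=.
rewrite [X in _ = lebesgue_measure X](_ : _ = `]a - c, b - c]%classic); last first.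
  by apply/seteqP; split => x /=; rewrite !in_itv /= ltrBlDr lerBrDr.
rewrite !lebesgue_measure_itv /= !lte_fin ltrD2r.
by case: ifP => // _; rewrite -!EFinD; congr EFin; lra.
Qed.

(* [bit 0] is the digit just after the binary point; [Num.truncn] is [0] on
   negative numbers, so all bits of a negative number are [false]. *)
Definition bit {R : realType} (k : nat) (t : R) : bool :=
  odd (Num.truncn (2 ^+ k.+1 * t)).

(** With [n] a power of two, this recovers an earlier binary digit from a finer integer part. *)
Lemma truncn_natM_divn (R : realType) (n : nat) (x : R) :
  (0 < n)%N -> 0 <= x -> (Num.truncn (n%:R * x) %/ n)%N = Num.truncn x.
Proof.
move=> n0 x0; apply/esym/truncn_def.
have nx0 : 0 <= n%:R * x by rewrite mulr_ge0.
have /andP[lo hi] := truncn_itv nx0.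
have n0R : 0 < n%:R :> R by rewrite ltr0n.
apply/andP; split.
  rewrite -(ler_pM2l n0R) (le_trans _ lo)// -natrM ler_nat mulnC.
  exact: leq_divM.
rewrite -(ltr_pM2l n0R) (lt_le_trans hi)// -natrM ler_nat mulnC.
exact: ltn_ceil.
Qed.

(** No carry occurs. Adding [2 ^- k.+1] raises the integer part of [2 ^+ k.+1 * t], which is even,
    by one. For [j > k] the integer part that defines bit [j] grows by the even number
    [2 ^ (j - k)]. For [j < k] bit [j] depends only on the halved integer part at level [k], which
    is the same for an even number and its successor. *)
Lemma bit_flip (R : realType) (k : nat) (t : R) : 0 <= t -> ~~ bit k t ->
  bit k (t + 2 ^- k.+1) /\
  (forall j, j != k -> bit j (t + 2 ^- k.+1) = bit j t).
Proof.
move=> t0; rewrite /bit => tk.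
have u2 m : (2 ^+ m : R) != 0 by rewrite expf_neq0.
have pos m : 0 <= 2 ^+ m * t by rewrite mulr_ge0// exprn_ge0.
have t'0 : 0 <= t + 2 ^- k.+1 by rewrite addr_ge0// invr_ge0 exprn_ge0.
have up j : (k <= j)%N -> Num.truncn (2 ^+ j.+1 * (t + 2 ^- k.+1)) =
    (2 ^ (j - k) + Num.truncn (2 ^+ j.+1 * t))%N.
  move=> kj; rewrite mulrDr addrC.
  rewrite -[X in 2 ^+ X.+1 / _](subnK kj) -addnS exprD mulfK//.
  by rewrite -natrX truncnD ?natrK ?natr_nat ?nnegrE.
have kk : Num.truncn (2 ^+ k.+1 * (t + 2 ^- k.+1)) =
    (Num.truncn (2 ^+ k.+1 * t)).+1 by rewrite up// subnn.
split; first by rewrite kk.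
move=> j; rewrite neq_ltn => /orP[jk|kj]; last first.
  by rewrite up 1?ltnW// oddD oddX subn_eq0 leqNgt kj.
have down (s : R) : 0 <= s -> Num.truncn (2 ^+ j.+1 * s) =
   ((Num.truncn (2 ^+ k.+1 * s))%/2 %/ 2 ^ (k - j.+1))%N.
  move=> s0; rewrite -divnMA -expnS -subSn//.
  have s'0 : 0 <= 2 ^+ j.+1 * s by rewrite mulr_ge0// exprn_ge0.
  rewrite -[LHS](@truncn_natM_divn R (2 ^ (k.+1 - j.+1)) _ _ s'0) ?expn_gt0//.
  by rewrite mulrA natrX -exprD subnK// ltnS ltnW.
rewrite !down// kk !divn2 -[in LHS](even_halfK tk) -(even_halfK tk).
by rewrite -[_.*2.+1]/(true + _)%N half_bit_double doubleK.
Qed.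

Lemma measurable_bit (R : realType) (k : nat) :
  measurable [set t : R | bit k t].
Proof.
have mk (m : nat) : measurable [set t : R | (m < Num.truncn (2 ^+ k.+1 * t))%N].
  rewrite (_ : [set _ | _] = `[m.+1%:R / 2 ^+ k.+1, +oo[%classic)//.
  apply/seteqP; split => t /=;
    by rewrite truncn_gt_nat in_itv /= andbT ler_pdivrMr ?exprn_gt0// mulrC.
(* Each difference is the set where the integer part equals [m]; as [m] is odd it is positive, so
   [m.-1] is a true predecessor. *)
rewrite (_ : [set _ | _] = \bigcup_(m in [set m | odd m])
    ([set t | m.-1 < Num.truncn (2 ^+ k.+1 * t)]%N `\`
     [set t | m < Num.truncn (2 ^+ k.+1 * t)]%N)); last first.
  apply/seteqP; split => [t tk|t [m /= om [mt /negP]]].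
    exists (Num.truncn (2 ^+ k.+1 * t)) => //=; rewrite ltnn; split => //.
    by move: tk; rewrite /= /bit; case: Num.truncn.
  rewrite /bit -leqNgt; case: m om mt => // m om /= mt tm.
  by rewrite (_ : Num.truncn _ = m.+1)//; apply/eqP; rewrite eqn_leq tm.
by apply: bigcup_measurable => m _; apply: measurableD.
Qed.

(** * Sets without two points that differ in exactly one bit *)

(** Translation by [2 ^- k.+1] carries the left half of the dyadic interval, where bit [k] is off,
    onto the right half, and sends [E] there into the complement of [E]. So both parts of [E]
    together measure at most one half. *)
Lemma measure_half_dyadic (R : realType) (E : set R) (k a : nat) :
  measurable E ->
  (forall t, E t -> ~~ bit k t -> ~ E (t + 2 ^- k.+1)) ->
  ((lebesgue_measure
     (E `&` `[(a.*2)%:R * 2 ^- k.+1, (a.*2.+2)%:R * 2 ^- k.+1[%classic))%R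
    <= (2 ^- k.+1)%:E)%E.
Proof.
move=> mE Eflip; set h : R := 2 ^- k.+1.
have h0 : 0 < h by rewrite invr_gt0 exprn_gt0.
pose I0 := `[(a.*2)%:R * h, (a.*2.+1)%:R * h[%classic.
pose I1 := `[(a.*2.+1)%:R * h, (a.*2.+2)%:R * h[%classic.
have -> : E `&` `[(a.*2)%:R * h, (a.*2.+2)%:R * h[%classic =
    (E `&` I0) `|` (E `&` I1).
  rewrite -setIUr; congr (_ `&` _); apply/esym.
  by rewrite -itv_bndbnd_setU// bnd_simp ler_pM2r// ler_nat.
have -> : (h%:E = lebesgue_measure I1)%E.
  rewrite lebesgue_measure_itv /= lte_fin ltr_pM2r// ltr_nat ltnSn.
  by rewrite -EFinD -mulrBl -(natrB _ (leqnSn _)) subSnn mul1r.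
have mI0 : measurable I0 by exact: measurable_itv.
have mI1 : measurable I1 by exact: measurable_itv.
have -> : lebesgue_measure I1 =
    (lebesgue_measure (I1 `\` E) + lebesgue_measure (E `&` I1))%E.
  by rewrite (setIC E) -measureDI.
apply: (le_trans (measureU2 _ _ _)); [exact: measurableI..|].
rewrite leeD2r// -(@lebesgue_measure_preimage_addr _ h (_ `\` _)); last first.
  exact: measurableD.
have mD : measurable ((fun x => x + h) @^-1` (I1 `\` E)).
  have mf : measurable_fun [set: R] (fun x : R => x + h).
    exact: measurable_funD.
  by rewrite -[X in measurable X]setTI; apply: mf => //; exact: measurableD.
apply: le_measure; rewrite ?inE//; first exact: measurableI.
move=> t [Et]; rewrite /I0 /I1 /= !in_itv /= => /andP[t0 t1]; split.
  rewrite -![a.*2.+2%:R]natr1 -![a.*2.+1%:R]natr1 !mulrDl !mul1r.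
  by rewrite lerD2r ltrD2r t0 /=; move: t1; rewrite -natr1 mulrDl mul1r.
(* On the left half the integer part of [2 ^+ k.+1 * t] is the even number [a.*2]. *)
apply: Eflip => //; rewrite /bit (_ : Num.truncn _ = a.*2) ?odd_double//.
apply: truncn_def; rewrite mulrC -ler_pdivrMr ?exprn_gt0// t0 /=.
by rewrite -ltr_pdivlMr ?exprn_gt0.
Qed.

Lemma negligible_no_bit_flip (R : realType) (E : set R) :
  measurable E -> (forall t, E t -> 0 <= t) ->
  (forall k t, E t -> ~~ bit k t -> ~ E (t + 2 ^- k.+1)) ->
  lebesgue_measure E = 0%E.
Proof.
move=> mE E0 Eflip; apply/negligibleP => //.
have := lebesgue_density mE; apply: negligibleS => x Ex /=.
rewrite /= indicE mem_set//= => dens.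
(* The ball has length [2 * 2 ^- k] and contains the dyadic interval [I] of length [2 ^- k] around
   [x]. [E] fills at most half of [I], which leaves [2 ^- k / 2 + 2 ^- k]. The density ratio is thus
   at most [3 / 4] at every scale, so it cannot tend to [1]. *)
have bnd k : (lebesgue_measure (E `&` ball x (2 ^- k)) <=
              (3 / 2 * 2 ^- k)%:E)%E.
  set h : R := 2 ^- k.+1.
  have kh : 2 ^- k = 2 * h by rewrite /h exprS invfM mulrA divff ?mul1r.
  have h0 : 0 < h by rewrite invr_gt0 exprn_gt0.
  have x0 := E0 _ Ex.
  set a := Num.truncn (2 ^+ k * x).
  have /andP[xa1 xa2] : a%:R <= 2 ^+ k * x < a.+1%:R.
    by apply: truncn_itv; rewrite mulr_ge0// exprn_ge0.
  pose I := `[(a.*2)%:R * h, (a.*2.+2)%:R * h[%classic.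
  have mI : measurable I by exact: measurable_itv.
  have mB : measurable (ball x (2 ^- k)) by exact: measurable_ball.
  have mu_I : lebesgue_measure I = (2 * h)%:E.
    rewrite lebesgue_measure_itv /= lte_fin ltr_pM2r// ltr_nat ltnS leqnSn.
    by rewrite -EFinD -mulrBl -[a.*2.+2]addn2 natrD addrAC subrr add0r.
  have IB : I `<=` ball x (2 ^- k).
    have hx : 2 ^+ k * x * (2 * h) = x.
      by rewrite -kh mulrAC divff ?mul1r// expf_neq0.
    have h2 : 0 < 2 * h by rewrite mulr_gt0.
    move: xa1 xa2; rewrite -(ler_pM2r h2) -(ltr_pM2r h2) hx -natr1 => xa1 xa2.
    move=> t; rewrite ball_itv kh /I /= !in_itv /=.
    rewrite -[a.*2.+2]addn2 natrD -muln2 natrM => /andP[t1 t2].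
    by apply/andP; split; lra.
  have muBI : lebesgue_measure (ball x (2 ^- k) `\` I) = (2 * h)%:E.
    have muB : lebesgue_measure (ball x (2 ^- k)) = (2 * h *+ 2)%:E.
      by rewrite lebesgue_measure_ball kh// mulr_ge0// ltW.
    rewrite measureD//; last by rewrite [X in (X < _)%E]muB ltry.
    rewrite [X in (X - _)%E]muB (setIidr IB) [X in (_ - X)%E]mu_I.
    by rewrite -EFinB; congr EFin; lra.
  apply: (@le_trans _ _
    (lebesgue_measure ((E `&` I) `|` (ball x (2 ^- k) `\` I)))).
    apply: le_measure; rewrite ?inE; first exact: measurableI.
      by apply: measurableU; [exact: measurableI|exact: measurableD].
    move=> t [Et Bt]; have [It|It] := pselect (I t); [by left|by right].
  apply: (le_trans (measureU2 _ _ _)); [exact: measurableI|exact: measurableD|].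
  rewrite [X in (_ + X)%E]muBI kh.
  apply: (@le_trans _ _ (h%:E + (2 * h)%:E)%E).
    by apply: leeD2r; apply: measure_half_dyadic => // t; exact: Eflip.
  by rewrite -EFinD lee_fin; lra.
have /dens : nbhs 1%E (fun u : \bar R => (3 / 4)%:E < u)%E.
  by apply: open_ereal_gt'; rewrite lte_fin; lra.
move=> [/= e e0 He].
have [k _ /(_ k (leqnn k)) ke] := near_infty_natSinv_expn_lt (PosNum e0).
have k0 : 0 < 2 ^- k :> R by rewrite invr_gt0 exprn_gt0.
have : ((3 / 4)%:E < lebesgue_measure (E `&` ball x (2 ^- k)) *
                     (lebesgue_measure (ball x (2 ^- k)))^-1)%E.
  apply: He => //=; rewrite sub0r normrN gtr0_norm//.
  by move: ke; rewrite /= div1r.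
apply/negP; rewrite -leNgt lebesgue_measure_ball ?(ltW k0)//.
rewrite inver mulrn_eq0 /= gt_eqF//.
apply: (@le_trans _ _ ((3 / 2 * 2 ^- k)%:E * ((2 ^- k *+ 2)^-1)%:E)%E).
  by apply: lee_wpmul2r => //; rewrite lee_fin invr_ge0 mulrn_wge0// ltW.
rewrite -EFinM lee_fin; set u := 2 ^- k in k0 *.
by rewrite ler_pdivrMr ?mulrn_wgt0//; lra.
Qed.

(** * Finite products selected by bits *)

Section topological_group.
Context {G : topologicalGroupType}.

Lemma continuous_mulgl (g : G) : continuous (fun x : G => (g * x)%g).
Proof.
move=> x; apply: (@continuous_comp _ _ _ (fun y => (g, y))
  (fun xy : G * G => (xy.1 * xy.2)%g)); last exact: mulg_continuous.
by apply: cvg_pair; [exact: cvg_cst|exact: cvg_id].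
Qed.

Lemma borel_set_lcoset (g : G) (A : set G) :
  borel_set A -> borel_set [set (g * a)%g | a in A].
Proof.
move=> mA; pose f : borelType G -> borelType G := fun x => (g^-1 * x)%g.
have mf : measurable_fun [set: borelType G] f.
  apply: (measurability (rT := borelType G) (@open G) erefl) => _ [U oU <-].
  rewrite setTI; apply: sub_sigma_algebra.
  by apply: open_comp => // x _; exact: continuous_mulgl.
have := mf measurableT _ mA; rewrite setTI; congr measurable.
apply/seteqP; split => x /=.
  by move=> Ax; exists (f x) => //; rewrite /f mulgA mulgV mul1g.
by move=> [a Aa <-]; rewrite /f mulgA mulVg mul1g.
Qed.

Lemma conjugacy_invariantJ (S : set G) (g x : G) :
  conjugacy_invariant S -> S x -> S (g * x * g^-1)%g.
Proof. by move=> /(_ g) SJ Sx; rewrite -SJ; exists x. Qed.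

Fixpoint bit_prod (b : nat -> G) (e : nat -> bool) (n : nat) : G :=
  if n is m.+1 then
    if e m then (bit_prod b e m * b m)%g else bit_prod b e m
  else 1%g.

(** With common prefix [u], the two products are [u v] and [u b_k v = (u b_k u^-1) (u v)]. The left
    factor does not depend on [n], so the relation can pass to the limit. *)
Lemma bit_prod_flip (b : nat -> G) (e e' : nat -> bool) (k n : nat) :
  ~~ e k -> e' k -> (forall j, j != k -> e' j = e j) -> (k < n)%N ->
  bit_prod b e' n =
    (bit_prod b e k * b k * (bit_prod b e k)^-1 * bit_prod b e n)%g.
Proof.
move=> ek e'k ee'.
have low m : (m <= k)%N -> bit_prod b e' m = bit_prod b e m.
  elim: m => //= m IH mk; rewrite ee' ?(ltn_eqF mk)// IH//.
  exact: ltnW.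
elim: n => // n IH; rewrite ltnS leq_eqVlt => /predU1P[<-|kn] /=.
  by rewrite e'k (negPf ek) low// -mulgA mulVg mulg1.
rewrite ee' ?gtn_eqF// IH//; case: ifP => // _.
by rewrite !mulgA.
Qed.

(** The product depends only on the first [n] bits, hence is constant on each of finitely many
    measurable pieces. The induction varies [S], since a last factor [b n] replaces [S] by a right
    translate. *)
Lemma measurable_bit_prod (R : realType) (b : nat -> G) (n : nat) (S : set G) :
  measurable [set t : R | S (bit_prod b (bit^~ t) n)].
Proof.
elim: n S => [|n IH] S /=.
  have [S1|S1] := pselect (S 1%g).
    by rewrite (_ : [set _ | _] = [set: R])//; apply/seteqP; split.
  by rewrite (_ : [set _ | _] = set0 :> set R)//; apply/seteqP; split.
rewrite (_ : [set _ | _] =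
    ([set t : R | bit n t] `&` [set t : R | S (bit_prod b (bit^~ t) n * b n)%g]) `|`
    (~` [set t : R | bit n t] `&` [set t : R | S (bit_prod b (bit^~ t) n)])).
  apply: measurableU; apply: measurableI => //.
  - exact: (measurable_bit R n).
  - exact: (IH [set x | S (x * b n)%g]).
  - exact: measurableC (measurable_bit R n).
apply/seteqP; split => t /=.
  by case: ifP => tn St; [left|right; split => //; rewrite tn].
by case=> -[+ St]; [move=> ->|case: ifP].
Qed.

End topological_group.

(** * Geometric convergence in a complete metric *)

Lemma half_pow_lt {R : realType} {e : R} : 0 < e ->
  exists n, forall m, (n <= m)%N -> 2 * 2 ^- m < e.
Proof.
move=> e0; have e2 : 0 < e / 2 by rewrite divr_gt0.
have [n _ Hn] := near_infty_natSinv_expn_lt (PosNum e2).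
exists n => m nm; have := Hn m nm; rewrite /= div1r; lra.
Qed.

Section metric.
Context {R : realType} {T : topologicalType} {d : T -> T -> R}.
Context (dM : is_metric d) (dT : metric_induces_topology d).

Lemma open_metric_ball (x : T) (e : R) : open [set y | d x y < e].
Proof.
have [_ _ _ tri] := dM.
apply/dT => y /= xy; exists (e - d x y); first by rewrite subr_gt0.
by move=> z /=; rewrite ltrBrDl; exact: le_lt_trans.
Qed.

Lemma nbhs_metric_ball (x : T) (e : R) : 0 < e -> nbhs x [set y | d x y < e].
Proof.
have [_ d0 _ _] := dM.
by move=> e0; apply: open_nbhs_nbhs; split;
  [exact: open_metric_ball|rewrite /= (d0 x x).2].
Qed.

Lemma continuous_metric (f : T -> T) (x : T) (e : R) : continuous f -> 0 < e ->
  exists2 r, 0 < r & forall y, d x y < r -> d (f x) (f y) < e.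
Proof.
move=> cf e0; have oU : open (f @^-1` [set y | d (f x) y < e]).
  by apply: open_comp => [y _|]; [exact: cf|exact: open_metric_ball].
have [_ d0 _ _] := dM.
have [|r r0 Hr] := (dT _).1 oU x; first by rewrite /= (d0 _ _).2.
by exists r.
Qed.

Lemma geometric_cauchy_limit (u : nat -> T) : metric_complete d ->
  (forall n, d (u n) (u n.+1) <= 2 ^- n) ->
  exists l, forall n, d (u n) l <= 2 * 2 ^- n.
Proof.
have [dge0 d0 dC tri] := dM; move=> dc du.
(* Subtracting the remaining tail of the geometric series makes the induction on [m] close. *)
have dist n m : d (u n) (u (n + m)%N) <= 2 * 2 ^- n - 2 * 2 ^- (n + m).
  elim: m => [|m IH]; first by rewrite addn0 (d0 _ _).2// subrr.
  apply: (le_trans (tri _ (u (n + m)%N) _)).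
  have := du (n + m)%N; rewrite addnS exprS invfM; lra.
have dist' n m : (n <= m)%N -> d (u n) (u m) <= 2 * 2 ^- n.
  move=> nm; have := dist n (m - n)%N; rewrite subnKC//.
  have : 0 < 2 ^- m :> R by rewrite invr_gt0 exprn_gt0.
  lra.
have [l ul] : exists l, metric_cvg_seq d u l.
  apply: dc => e e0; have [|N HN] := @half_pow_lt R (e / 2).
    by rewrite divr_gt0.
  exists N => m n Nm Nn; apply: (le_lt_trans (tri _ (u N) _)).
  have := dist' _ _ Nm; have := dist' _ _ Nn; have := HN N (leqnn _).
  rewrite (dC (u m)); lra.
exists l => n; apply/ler_addgt0Pr => e e0; have [N HN] := ul _ e0.
apply: (le_trans (tri _ (u (maxn n N)) _)); apply: lerD.
  exact/dist'/leq_maxl.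
exact/ltW/HN/leq_maxr.
Qed.

End metric.

(** * The infinite product and its dependence on the bits *)

Section random_product.
Context {R : realType} {G : topologicalGroupType} {d : G -> G -> R}.
Context (dM : is_metric d) (dT : metric_induces_topology d).

(** Each [p] gives a neighbourhood of [1] by continuity of left multiplication; the finite
    intersection of these meets [B]. *)
Lemma closure_small_translate (B : set G) (s : seq G) (e : R) :
  closure B 1%g -> 0 < e ->
  exists2 b, B b & forall p, p \in s -> d p (p * b)%g < e.
Proof.
move=> B1 e0; suff /B1[b [Bb sb]] :
  nbhs (1%g : G) [set b | forall p, p \in s -> d p (p * b)%g < e] by exists b.
elim: s => [|p s IH]; first exact: filterE.
have : nbhs (1%g : G) [set b | d p (p * b)%g < e].
  apply: (@continuous_mulgl G p 1%g [set y | d p y < e]).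
  by rewrite mulg1; exact: nbhs_metric_ball.
move: IH; apply: filterS2 => b /= sb pb q.
by rewrite inE => /predU1P[->|/sb].
Qed.

(** At stage [n] there are only finitely many partial products over all bit sequences, so a single
    factor [b n] can move all of them by less than [2 ^- n]. *)
Lemma exists_summable_factors (B : set G) : closure B 1%g ->
  exists2 b : nat -> G, forall k, B (b k) &
    forall e n, d (bit_prod b e n) (bit_prod b e n.+1) <= 2 ^- n.
Proof.
have [_ d0 _ _] := dM; move=> B1.
have h0 n : 0 < 2 ^- n :> R by rewrite invr_gt0 exprn_gt0.
have /choice[f fP] (ns : nat * seq G) : exists b, B b /\
    forall p, p \in ns.2 -> d p (p * b)%g < 2 ^- ns.1.
  have [b Bb Hb] := @closure_small_translate B ns.2 _ B1 (h0 ns.1).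
  by exists b.
(* [S n] lists the possible products of the first [n] factors; the next factor is chosen from [n]
   and this list. *)
pose S := fix S n : seq G := if n is m.+1 then
  S m ++ [seq (p * f (m, S m))%g | p <- S m] else [:: 1%g].
pose b n := f (n, S n).
have bS e n : bit_prod b e n \in S n.
  elim: n => [|n IH] /=; first by rewrite inE.
  rewrite mem_cat; case: ifP => _; rewrite ?IH//.
  by rewrite (map_f (fun p => p * b n)%g) ?orbT.
exists b => [k|e n /=]; first exact: (fP (k, S k)).1.
case: ifP => _; last by rewrite (d0 _ _).2// ltW.
exact/ltW/(fP (n, S n)).2.
Qed.

Context {b : nat -> G} {phi : (nat -> bool) -> G}.
Context (phiP : forall e n, d (bit_prod b e n) (phi e) <= 2 * 2 ^- n).

Lemma limit_prod_flip (e e' : nat -> bool) (k : nat) :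
  ~~ e k -> e' k -> (forall j, j != k -> e' j = e j) ->
  exists g, ((phi e)^-1 * phi e' = g * b k * g^-1)%g.
Proof.
have [dge0 d0 dC tri] := dM; move=> ek e'k ee'.
pose p := bit_prod b e k; pose c := (p * b k * p^-1)%g.
exists ((phi e)^-1 * p)%g; rewrite invgM invgK.
suff -> : phi e' = (c * phi e)%g by rewrite /c !mulgA.
apply/(d0 _ _).1/eqP; rewrite eq_le dge0 andbT.
apply/ler_addgt0Pr => r r0; rewrite add0r.
have r2 : 0 < r / 2 by rewrite divr_gt0.
(* The metric is not assumed invariant, so continuity of left multiplication by [c] at [phi e]
   carries the finite identity to the limit. *)
have [s s0 Hs] := continuous_metric dM dT _ (phi e) _ (continuous_mulgl c) r2.
have [N1 HN1] := half_pow_lt s0; have [N2 HN2] := half_pow_lt r2.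
pose n := maxn k.+1 (maxn N1 N2).
have kn : (k < n)%N by exact: leq_maxl.
apply: (le_trans (tri _ (bit_prod b e' n) _)).
have h1 : d (phi e') (bit_prod b e' n) < r / 2.
  rewrite dC; apply: le_lt_trans (phiP _ _) (HN2 _ _).
  by rewrite /n !leq_max leqnn !orbT.
have : d (c * phi e)%g (c * bit_prod b e n)%g < r / 2.
  apply: Hs; rewrite dC; apply: le_lt_trans (phiP _ _) (HN1 _ _).
  by rewrite /n !leq_max leqnn !orbT.
rewrite (bit_prod_flip b _ _ _ _ ek e'k ee' kn) -/p -/c in h1 *.
rewrite (dC (c * phi e)%g); lra.
Qed.

(** The limit lies in an open [U] exactly when, for some [n], the closed ball of radius [2 * 2 ^- n]
    around the [n]-th partial product lies in [U]; each such condition involves finitely many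
    bits. *)
Lemma measurable_limit_prod :
  measurable_fun [set: R] (fun t : R => phi (bit^~ t) : borelType G).
Proof.
have [dge0 d0 dC tri] := dM.
apply: (measurability (rT := borelType G) (@open G) erefl) => _ [U oU <-]; rewrite setTI.
rewrite (_ : _ @^-1` _ = \bigcup_n [set t : R |
    [set x | forall y, d x y <= 2 * 2 ^- n -> U y] (bit_prod b (bit^~ t) n)]).
  by apply: bigcup_measurable => n _; exact: measurable_bit_prod.
apply/seteqP; split => t /=; last by move=> [n _]; apply.
move=> Ut; have [r r0 Hr] := (dT _).1 oU _ Ut.
have r2 : 0 < r / 2 by rewrite divr_gt0.
have [N HN] := half_pow_lt r2; exists N => //= y Hy; apply: Hr => /=.
apply: (le_lt_trans (tri _ (bit_prod b (bit^~ t) N) _)).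
have := HN _ (leqnn _); have := phiP (bit^~ t) N; rewrite dC; lra.
Qed.

End random_product.

(** * The law of the random product vanishes on all translates *)

(** The uniform density vanishes off [[0, 1]], and the uniform law is absolutely continuous with
    respect to Lebesgue measure. *)
Lemma uniform_prob01_null (R : realType) (E : set R) : measurable E ->
  lebesgue_measure (E `&` `[0, 1]%classic) = 0%E ->
  uniform_prob (@ltr01 R) E = 0%E.
Proof.
move=> mE E0; rewrite /uniform_prob integral_uniform_pdf.
have mE01 : measurable (E `&` `[0, 1]%classic) by exact: measurableI.
have /null_content_dominatesP := @dominates_uniform_prob R _ _ ltr01.
by move=> /(_ _ mE01 E0).
Qed.

Theorem theorem2p8 (R : realType) (G : topologicalGroupType)
    (polishG : polish_space R G)
    (A : set G) (A_inv : conjugacy_invariant A)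
    (A_ : nat -> set G) (A_borel : forall n, borel_set (A_ n))
    (A_cup : A = \bigcup_n A_ n)
    (B_ex : exists B : set G,
      [/\ conjugacy_invariant B,
          closure B 1%g &
          B `&` \bigcup_n invg_mulg_set (A_ n) = set0]) :
  haar_null R A.
Proof.
have [_ [d [dM dT dc]]] := polishG.
have [B [B_inv B1 BA]] := B_ex.
have [b bB b_sum] := exists_summable_factors dM dT B B1.
have /choice[phi phiP] (e : nat -> bool) :
    exists l, forall n, d (bit_prod b e n) l <= 2 * 2 ^- n.
  exact: (geometric_cauchy_limit dM _ dc (b_sum e)).
pose f : measurableTypeR R -> borelType G := fun t => phi (bit^~ t).
have mf : measurable_fun [set: measurableTypeR R] f.
  exact: (measurable_limit_prod dM dT phiP).
pose fM := isMeasurableFun.Build _ _ _ _ f mf.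
pose X : {mfun measurableTypeR R >-> borelType G} := HB.pack f fM.
exists A => //; split.
  by rewrite A_cup; apply: bigcup_measurable => n _; exact: A_borel.
exists (distribution (uniform_prob (@ltr01 R)) X) => g h.
(* This rests on [g a h = (g h) (h^-1 a h)] and the invariance of [A] under conjugation. *)
have -> : [set (g * a * h)%g | a in A] =
    \bigcup_n [set (g * h * a)%g | a in A_ n].
  rewrite -image_bigcup -A_cup; apply/seteqP; split => _ [a Aa <-].
    exists (h^-1 * a * h^-1^-1)%g; first exact: conjugacy_invariantJ.
    by rewrite invgK !mulgA mulgK.
  exists (h * a * h^-1)%g; first exact: conjugacy_invariantJ.
  by rewrite !mulgA mulgVK.
have mgA n : borel_set [set (g * h * a)%g | a in A_ n].
  exact: borel_set_lcoset.
apply/negligibleP; first by apply: bigcup_measurable => n _; exact: mgA.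
apply: negligible_bigcup => n; apply/negligibleP; first exact: mgA.
rewrite /distribution /pushforward /=.
set E := f @^-1` _.
have mE : measurable E by rewrite -[E]setTI; exact: (mf measurableT _ (mgA n)).
(* Intersecting with [[0, 1]] supplies the nonnegativity that flipping a bit by addition
   requires. *)
apply: uniform_prob01_null => //; apply: negligible_no_bit_flip.
- exact: measurableI.
- by move=> t [_]; rewrite /= in_itv /= => /andP[].
move=> k t [[a Aa fa] /=]; rewrite in_itv /= => /andP[t0 _] tk [[a' Aa' fa'] _].
have [t'k t't] := bit_flip _ _ _ t0 tk.
have [c cE] := limit_prod_flip dM dT phiP
  (bit^~ t) (bit^~ (t + 2 ^- k.+1)) k tk t'k t't.
suff : (B `&` \bigcup_n invg_mulg_set (A_ n)) (a^-1 * a')%g by rewrite BA.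
split; last by exists n => //; exists a => //; exists a'.
(* The two limits are [g h a] and [g h a'], so the common translation cancels in their left
   quotient. *)
have -> : (a^-1 * a' = c * b k * c^-1)%g.
  rewrite -cE -[phi (bit^~ t)]fa -[phi (bit^~ (t + _))]fa'.
  by rewrite invgM -mulgA mulKg.
exact: conjugacy_invariantJ.
Qed.
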